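(* Let $n\in\mathbb{N}$, $m\ge 2$, let $A\in\{0,1\}^{n\times m}$ have no zero column, and let $c\in\mathbb{R}^m$ with $c_i>0$ for all $i$, $d\in\mathbb{R}^m$ with $d_i\ge 0$ for all $i$, and $d_0>0$. Consider the combinatorial ratio game $$\nu(w)=\max_{x\in\{0,1\}^m}\left[\frac{c^Tx}{d_0+d^Tx}:\ Ax\le w\right],\qquad w\in\{0,1\}^n.$$ Let $K=\{i\in[m]:d_i=0\}$ and let $\overline{A}$ be the matrix obtained from $A$ by retaining exactly the columns with index in $K$. Then $\nu$ has a non-empty core if and only if $$\max_{x\in\mathbb{R}^m_+}\left[\sum_{i=1}^m\frac{c_i}{d_0+d_i}x_i:\ Ax\le\mathbf{1}_n\right]=\max\left\{\max_{i\in[m]}\frac{c_i}{d_0+d_i},\ \max_{x\in\{0,1\}^{K}}\left[\sum_{k\in K}\frac{c_k}{d_0}x_k:\ \overline{A}x\le\mathbf{1}_n\right]\right\}.$$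
   Context: Notation: $[m]=\{1,\dots,m\}$; $\mathbf{1}_n$ is the all-one vector; $\mathbb{R}^m_+$ is the set of componentwise non-negative vectors; vector inequalities are componentwise. If $K=\emptyset$, the inner maximum over $\{0,1\}^K$ is $0$ by convention. The core of a (revenue) game $\nu:\{0,1\}^n\to\mathbb{R}$ is $\mathrm{core}(\nu)=\{y\in\mathbb{R}^n:\mathbf{1}_n^Ty=\nu(\mathbf{1}_n),\ a^Ty\ge\nu(a)\ \forall a\in\{0,1\}^n\}$. *)

(* Defs.v *)
From HB Require Import structures.
From mathcomp Require Import all_boot all_order all_algebra.
From mathcomp Require Import all_classical all_reals.
Set Implicit Arguments.
Unset Strict Implicit.
Unset Printing Implicit Defensive.
Import Order.TTheory GRing.Theory Num.Theory.
Local Open Scope classical_set_scope.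
Local Open Scope ring_scope.

(* 0/1 matrices and vectors are boolean matrices, which form a finite type;
   mx01 embeds them in the real matrices. *)
Definition mx01 (R : realType) (p q : nat) (B : 'M[bool]_(p, q)) : 'M[R]_(p, q) :=
  map_mx (fun b : bool => b%:R) B.
Arguments mx01 R {p q} B.

Definition dotcv (R : realType) (p : nat) (u v : 'cV[R]_p) : R :=
  (u^T *m v) 0 0.

Definition lecv (R : realType) (p : nat) (u v : 'cV[R]_p) : bool :=
  [forall i, u i 0 <= v i 0].

Definition is_max (R : realType) (S : set R) (v : R) : Prop :=
  S v /\ ubound S v.

Definition core (R : realType) (n : nat) (nu : 'cV[bool]_n -> R) : set 'cV[R]_n :=
  [set y | dotcv (const_mx 1) y = nu (const_mx true) /\
           forall a : 'cV[bool]_n, nu a <= dotcv (mx01 R a) y].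

Definition feasible01 (R : realType) (n m : nat) (A : 'M[bool]_(n, m))
    (w : 'cV[R]_n) (x : 'cV[bool]_m) : bool :=
  lecv (mx01 R A *m mx01 R x) w.

Definition ratio (R : realType) (m : nat) (c d : 'cV[R]_m) (d0 : R)
    (x : 'cV[bool]_m) : R :=
  dotcv c (mx01 R x) / (d0 + dotcv d (mx01 R x)).

(* The default value 0 of the iterated maximum is the ratio at x = 0, which is
   feasible for every w; see ratio_gameP. *)
Definition ratio_game (R : realType) (n m : nat) (A : 'M[bool]_(n, m))
    (c d : 'cV[R]_m) (d0 : R) (w : 'cV[bool]_n) : R :=
  \big[Num.max/0]_(x : 'cV[bool]_m | feasible01 A (mx01 R w) x) ratio c d d0 x.

Definition lp_feasible (R : realType) (n m : nat) (A : 'M[bool]_(n, m)) :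
    set 'cV[R]_m :=
  [set x | lecv 0 x /\ lecv (mx01 R A *m x) (const_mx 1)].
Arguments lp_feasible R {n m} A.

Definition lp_objective (R : realType) (m : nat) (c d : 'cV[R]_m) (d0 : R)
    (x : 'cV[R]_m) : R :=
  \sum_i c i 0 / (d0 + d i 0) * x i 0.

(* All these ratios are positive in the intended setting, so the default value
   0 is irrelevant as soon as m > 0; see max_singleP. *)
Definition max_single (R : realType) (m : nat) (c d : 'cV[R]_m) (d0 : R) : R :=
  \big[Num.max/0]_(i < m) (c i 0 / (d0 + d i 0)).

Definition zero_idx (R : realType) (m : nat) (d : 'cV[R]_m) : {set 'I_m} :=
  [set i | d i 0 == 0]%SET.

(* Vectors indexed by K are indexed by 'I_#|K| through the increasing
   enumeration enum_val of K. *)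
Definition retain_cols (T : Type) (n m : nat) (K : {set 'I_m}) (A : 'M[T]_(n, m)) :
    'M[T]_(n, #|K|) :=
  colsub (fun k : 'I_#|K| => enum_val k) A.

Definition packing_objective (R : realType) (m : nat) (K : {set 'I_m})
    (c : 'cV[R]_m) (d0 : R) (x : 'cV[bool]_#|K|) : R :=
  \sum_(k < #|K|) c (enum_val k) 0 / d0 * mx01 R x k 0.

(* Again 0 is the value at the feasible point x = 0; if K is empty the maximum
   is 0. *)
Definition max_packing (R : realType) (n m : nat) (K : {set 'I_m})
    (A : 'M[bool]_(n, m)) (c : 'cV[R]_m) (d0 : R) : R :=
  \big[Num.max/0]_(x : 'cV[bool]_#|K| |
      feasible01 (retain_cols K A) (const_mx 1 : 'cV[R]_n) x)
    packing_objective c d0 x.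

Lemma bigmax0P (R : realType) (I : finType) (P : pred I) (F : I -> R) (i0 : I) :
  P i0 -> 0 <= F i0 ->
  is_max [set F i | i in [set i | P i]] (\big[Num.max/0]_(i | P i) F i).
Proof.
move=> Pi0 Fi0; split; last first.
  by move=> _ [i /= Pi <-]; exact: le_bigmax_cond.
have le0 : 0 <= F [arg max_(i > i0 | P i) F i]%O.
  by case: arg_maxP => // i _ /(_ i0 Pi0); exact: le_trans.
move: le0; case: arg_maxP => // i Pi maxi Fi_ge0.
exists i => //; apply/eqP; rewrite eq_le le_bigmax_cond //=.
exact/bigmax_leP.
Qed.

Lemma mx01_0 (R : realType) (p q : nat) :
  mx01 R (const_mx false : 'M_(p, q)) = 0.
Proof. by apply/matrixP => i j; rewrite !mxE. Qed.

Lemma ratio_gameP (R : realType) (n m : nat) (A : 'M[bool]_(n, m))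
    (c d : 'cV[R]_m) (d0 : R) (w : 'cV[bool]_n) :
  is_max [set ratio c d d0 x | x in [set x | feasible01 A (mx01 R w) x]]
    (ratio_game A c d d0 w).
Proof.
apply: (@bigmax0P _ _ _ _ (const_mx false)).
  by apply/forallP => i; rewrite mx01_0 mulmx0 !mxE ler0n.
by rewrite /ratio /dotcv mx01_0 !mulmx0 !mxE mul0r.
Qed.

Lemma max_singleP (R : realType) (m : nat) (c d : 'cV[R]_m) (d0 : R) :
  (0 < m)%N -> (forall i, 0 < c i 0) -> (forall i, 0 <= d i 0) -> 0 < d0 ->
  is_max (range (fun i => c i 0 / (d0 + d i 0))) (max_single c d d0).
Proof.
move=> m_gt0 c_gt0 d_ge0 d0_gt0.
have -> : [set: 'I_m] = [set i | xpredT i] by apply/seteqP; split.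
apply: (@bigmax0P _ _ xpredT _ (Ordinal m_gt0)) => //.
by rewrite divr_ge0 ?addr_ge0 // ltW.
Qed.

Lemma max_packingP (R : realType) (n m : nat) (K : {set 'I_m})
    (A : 'M[bool]_(n, m)) (c : 'cV[R]_m) (d0 : R) :
  is_max [set packing_objective c d0 x | x in
      [set x | feasible01 (retain_cols K A) (const_mx 1 : 'cV[R]_n) x]]
    (max_packing K A c d0).
Proof.
apply: (@bigmax0P _ _ _ _ (const_mx false)).
  by apply/forallP => i; rewrite mx01_0 mulmx0 !mxE ler01.
by rewrite /packing_objective mx01_0 big1 // => k _; rewrite mxE mulr0.
Qed.

(* Main.v *)
Require Import Defs.
From mathcomp Require Import all_boot all_order all_algebra.
From mathcomp Require Import all_classical all_reals.
Set Implicit Arguments.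
Unset Strict Implicit.
Unset Printing Implicit Defensive.
Import Order.TTheory GRing.Theory Num.Theory.
Local Open Scope classical_set_scope.
Local Open Scope ring_scope.

(** Write p_i = c_i / (d0 + d_i) for the ratio of the single column i.

    A 0/1 vector x satisfies ratio(x) <= p^T x, since each chosen column
    contributes c_i / (d0 + d^T x), whose denominator is at least d0 + d_i
    ([ratio_le_lp]).  Hence a vector y satisfies the stability inequalities of
    the core exactly when it is feasible for the dual of the linear program
    max p^T x, i.e. y >= 0 and A^T y >= p: the unit vectors give one direction
    ([stable_dual]), weak duality the other ([dual_stable]).  The core is
    therefore the set of dual feasible points of value nu(1), and nu(1) is
    squeezed between the right-hand side of the theorem
    ([single_or_packing_le_game]) and every dual value.

    A core element thus forces ratio(x) = p^T x at an x attaining nu(1), and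
    this equality says that d^T x = d_i for each chosen i.  If two columns are
    chosen, then d vanishes on all chosen columns and x is a packing of columns
    of K; otherwise x is a single column or 0 ([tight_ratio]).  So nu(1) is at
    most the right-hand side.  Conversely, if the linear program has the stated
    optimal value, strong duality ([lp_strong_duality], from Farkas' lemma)
    provides a dual feasible point of at most that value; the squeeze makes its
    value nu(1), so it is a core element. *)

(** * Farkas' lemma and linear programming duality *)

(** The proof is by induction on the number of inequalities: if the first
    inequality a is needed, there is a direction x1 with a x1 = 1 that satisfies
    the others, and projecting along x1 onto the kernel of a eliminates it. *)
Lemma farkas (R : realFieldType) (k N : nat) (M : 'M[R]_(k, N)) (b : 'rV[R]_N) :
  (forall x : 'cV[R]_N,
     (forall i, (M *m x) i 0 <= 0) -> (b *m x) 0 0 <= 0) ->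
  exists2 l : 'rV[R]_k, (forall i, 0 <= l 0 i) & b = l *m M.
Proof.
elim: k M b => [M b Mb|k IHk].
  exists 0 => [i|]; first by rewrite mxE.
  have b_le0 (x : 'cV_N) : (b *m x) 0 0 <= 0 by apply: Mb => -[].
  rewrite mul0mx; apply/rowP => j; apply/eqP; rewrite mxE eq_le.
  have := b_le0 (- delta_mx j 0); have := b_le0 (delta_mx j 0).
  by rewrite mulmxN -colE !mxE oppr_le0 => -> ->.
rewrite -[k.+1]/(1 + k)%N => M b Mb.
pose a : 'rV[R]_N := usubmx M.
pose M' : 'M[R]_(k, N) := dsubmx M.
have defM : M = col_mx a M' by rewrite vsubmxK.
have M_le0 (x : 'cV_N) : (a *m x) 0 0 <= 0 -> (forall i, (M' *m x) i 0 <= 0) ->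
    forall i, (M *m x) i 0 <= 0.
  move=> ax M'x i; rewrite defM mul_col_mx.
  rewrite -[i]splitK; case: (fintype.split i) => j /=.
    by rewrite col_mxEu ord1.
  by rewrite col_mxEd.
have [[x0 [M'x0 bx0]]|noX] := pselect
    (exists x : 'cV_N, (forall i, (M' *m x) i 0 <= 0) /\ 0 < (b *m x) 0 0); last first.
  have [x M'x|l l_ge0 ->] := IHk M' b.
    by rewrite leNgt; apply/negP => bx; apply: noX; exists x.
  exists (row_mx (0 : 'M_1) l).
    move=> i; rewrite -[i]splitK; case: (fintype.split i) => j /=.
      by rewrite row_mxEl mxE.
    by rewrite row_mxEr.
  by rewrite [in RHS]defM mul_row_col mul0mx add0r.
have ax0 : 0 < (a *m x0) 0 0.
  by rewrite ltNge; apply/negP => ax0; move: bx0; rewrite ltNge Mb //; exact: M_le0.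
pose x1 := ((a *m x0) 0 0)^-1 *: x0.
have ax1 : a *m x1 = 1%:M.
  apply/matrixP => i j; rewrite !ord1 -scalemxAr mxE mulVf ?gt_eqF //.
  by rewrite mxE.
have M'x1 i : (M' *m x1) i 0 <= 0.
  by rewrite -scalemxAr mxE mulr_ge0_le0 // invr_ge0 ltW.
have bx1 : 0 <= (b *m x1) 0 0.
  by rewrite -scalemxAr mxE mulr_ge0 ?invr_ge0 // ltW.
(* the projection along x1 onto the kernel of a *)
pose P : 'M[R]_N := 1%:M - x1 *m a.
have aP : a *m P = 0 by rewrite mulmxBr mulmx1 mulmxA ax1 mul1mx subrr.
have [x M'Px|l l_ge0 bP] := IHk (M' *m P) (b *m P).
  rewrite -mulmxA; apply: Mb; apply: M_le0; first by rewrite mulmxA aP mul0mx mxE.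
  by move=> i; rewrite mulmxA.
exists (row_mx ((b - l *m M') *m x1) l).
  move=> i; rewrite -[i]splitK; case: (fintype.split i) => j /=.
    rewrite row_mxEl ord1 mulmxBl mxE addr_ge0 // mxE -mulmxA mxE oppr_ge0.
    by apply: sumr_le0 => s _; rewrite mulr_ge0_le0.
  by rewrite row_mxEr.
rewrite [in RHS]defM mul_row_col.
move: bP; rewrite /P mulmxBr mulmx1 -mulmxA mulmxBr mulmx1 mulmxBr => bP.
rewrite !mulmxBl -!mulmxA -[LHS](subrK (b *m (x1 *m a))) bP.
by rewrite addrC addrA addrAC.
Qed.

Lemma lp_weak_duality (R : realFieldType) (n m : nat) (A : 'M[R]_(n, m))
    (p x : 'cV[R]_m) (b y : 'cV[R]_n) :
  (forall i, 0 <= x i 0) -> (forall j, (A *m x) j 0 <= b j 0) ->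
  (forall j, 0 <= y j 0) -> (forall i, p i 0 <= (A^T *m y) i 0) ->
  (p^T *m x) 0 0 <= (b^T *m y) 0 0.
Proof.
move=> x_ge0 Axb y_ge0 Ayp; apply: (@le_trans _ _ (((A *m x)^T *m y) 0 0)).
  have -> : (A *m x)^T *m y = ((A^T *m y)^T *m x)^T.
    by rewrite !trmx_mul !trmxK mulmxA.
  rewrite [leRHS]mxE [leLHS]mxE [leRHS]mxE; apply: ler_sum => i _.
  by rewrite ler_wpM2r // [leLHS]mxE [leRHS]mxE.
rewrite [leLHS]mxE [leRHS]mxE; apply: ler_sum => j _.
by rewrite ler_wpM2r // [leLHS]mxE [leRHS]mxE.
Qed.

(** Farkas' lemma is applied to the homogenized system in (x, t), where t >= 0
    scales the right-hand side: x >= 0, t >= 0 and A x <= t b imply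
    p^T x <= V t. *)
Lemma lp_strong_duality (R : realFieldType) (n m : nat) (A : 'M[R]_(n, m))
    (p x0 : 'cV[R]_m) (b : 'cV[R]_n) (V : R) :
  (forall i, 0 <= x0 i 0) -> (forall j, (A *m x0) j 0 <= b j 0) ->
  (forall x : 'cV[R]_m, (forall i, 0 <= x i 0) ->
     (forall j, (A *m x) j 0 <= b j 0) -> (p^T *m x) 0 0 <= V) ->
  exists y : 'cV[R]_n, [/\ forall j, 0 <= y j 0,
    forall i, p i 0 <= (A^T *m y) i 0 & (b^T *m y) 0 0 <= V].
Proof.
move=> x0_ge0 Ax0 pV.
have [z Mz|l l_ge0] := @farkas R _ _ (col_mx (- 1%:M) (row_mx A (- b)))
    (row_mx p^T (- V%:M) : 'rV_(m + 1)).
  rewrite -[z]vsubmxK in Mz *; set x := usubmx z in Mz *; set t := dsubmx z in Mz *.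
  have x_ge0 i : 0 <= x i 0.
    have := Mz (lshift n (lshift 1 i)).
    by rewrite mul_col_mx col_mxEu mulNmx mul1mx mxE col_mxEu oppr_le0.
  have t_ge0 : 0 <= t 0 0.
    have := Mz (lshift n (rshift m 0)).
    by rewrite mul_col_mx col_mxEu mulNmx mul1mx mxE col_mxEd oppr_le0.
  have Axt j : (A *m x) j 0 <= t 0 0 * b j 0.
    have := Mz (rshift (m + 1) j).
    rewrite mul_col_mx col_mxEd mul_row_col mulNmx mxE [X in _ + X]mxE.
    by rewrite [X in _ - X]mxE big_ord1 subr_le0 mulrC.
  rewrite mul_row_col mulNmx mul_scalar_mx mxE [X in _ + X]mxE [X in _ - X]mxE.
  rewrite subr_le0.
  have [t0|t_neq0] := eqVneq (t 0 0) 0.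
    (* x is a recession direction of the feasible set, along which a positive
       p^T x would make the objective exceed V *)
    rewrite t0 mulr0 leNgt; apply/negP => px_gt0.
    pose s := (V - (p^T *m x0) 0 0 + 1) / (p^T *m x) 0 0.
    have s_ge0 : 0 <= s.
      by rewrite divr_ge0 ?(ltW px_gt0) // addr_ge0 // subr_ge0 pV.
    have: (p^T *m (x0 + s *: x)) 0 0 <= V.
      apply: pV => [i|j].
        by rewrite mxE [X in _ + X]mxE addr_ge0 // mulr_ge0.
      rewrite mulmxDr -scalemxAr mxE [X in _ + X]mxE -[leRHS]addr0 lerD //.
      by rewrite mulr_ge0_le0 // (le_trans (Axt j)) // t0 mul0r.
    rewrite mulmxDr -scalemxAr mxE [X in _ + X]mxE divfK ?gt_eqF //.
    by rewrite addrA (addrC _ (V - _)) subrK gerDl ler10.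
  have t_gt0 : 0 < t 0 0 by rewrite lt_neqAle eq_sym t_neq0.
  have: (p^T *m ((t 0 0)^-1 *: x)) 0 0 <= V.
    apply: pV => [i|j]; first by rewrite mxE mulr_ge0 ?invr_ge0.
    by rewrite -scalemxAr mxE ler_pdivrMl.
  by rewrite -scalemxAr mxE ler_pdivrMl // mulrC.
rewrite -[l]hsubmxK in l_ge0 *; set u := lsubmx l in l_ge0 *.
set v := rsubmx l in l_ge0 *.
have u_ge0 i : 0 <= u 0 i by have := l_ge0 (lshift n i); rewrite row_mxEl.
have v_ge0 j : 0 <= v 0 j by have := l_ge0 (rshift (m + 1) j); rewrite row_mxEr.
rewrite mul_row_col mulmxN mulmx1 mul_mx_row => /rowP defpV.
exists v^T; split=> [j|i|]; first by rewrite mxE.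
  have := defpV (lshift 1 i); rewrite row_mxEl mxE => ->.
  rewrite mxE row_mxEl -trmx_mul [leRHS]mxE gerDr mxE oppr_le0.
  exact: u_ge0.
have := defpV (rshift m 0); rewrite row_mxEr [LHS]mxE [RHS]mxE.
rewrite [X in - X = _]mxE row_mxEr mulmxN [X in X + _]mxE [X in _ + X]mxE => defV.
by rewrite -trmx_mul mxE -lerN2 defV gerDr oppr_le0; exact: u_ge0.
Qed.

(** * The ratio of a packing and its linear bound *)

Lemma dotcvE (R : realType) (p : nat) (u v : 'cV[R]_p) :
  dotcv u v = \sum_i u i 0 * v i 0.
Proof. by rewrite /dotcv mxE; apply: eq_bigr => i _; rewrite mxE. Qed.

Lemma dotcv01 (R : realType) (p : nat) (u : 'cV[R]_p) (x : 'cV[bool]_p) :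
  dotcv u (mx01 R x) = \sum_(i | x i 0) u i 0.
Proof.
rewrite dotcvE [RHS]big_mkcond; apply: eq_bigr => i _.
by rewrite mxE; case: (x i 0); rewrite ?mulr1 ?mulr0.
Qed.

(* The name ratio is shared with the type of fractions over an integral domain. *)
Local Notation ratio := Defs.ratio.

Lemma ratioE (R : realType) (m : nat) (c d : 'cV[R]_m) (d0 : R)
    (x : 'cV[bool]_m) :
  ratio c d d0 x =
  \sum_(i | x i 0) c i 0 / (d0 + \sum_(j | x j 0) d j 0).
Proof. by rewrite /ratio !dotcv01 mulr_suml. Qed.

(** The objective vector p of the linear program, p_i = c_i / (d0 + d_i). *)
Definition prices (R : realType) (m : nat) (c d : 'cV[R]_m) (d0 : R) : 'cV[R]_m :=
  \col_i (c i 0 / (d0 + d i 0)).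

Lemma lp_objectiveE (R : realType) (m : nat) (c d : 'cV[R]_m) (d0 : R)
    (x : 'cV[R]_m) :
  lp_objective c d d0 x = dotcv (prices c d d0) x.
Proof. by rewrite dotcvE; apply: eq_bigr => i _; rewrite mxE. Qed.

Lemma lp_objective01 (R : realType) (m : nat) (c d : 'cV[R]_m) (d0 : R)
    (x : 'cV[bool]_m) :
  lp_objective c d d0 (mx01 R x) = \sum_(i | x i 0) c i 0 / (d0 + d i 0).
Proof. by rewrite lp_objectiveE dotcv01; apply: eq_bigr => i _; rewrite mxE. Qed.

Lemma mx01_const1 (R : realType) (p q : nat) :
  mx01 R (const_mx true : 'M_(p, q)) = const_mx 1.
Proof. by apply/matrixP => i j; rewrite !mxE. Qed.

Lemma mx01_delta (R : realType) (p : nat) (j : 'I_p) :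
  mx01 R (\col_i (i == j)) = delta_mx j 0.
Proof. by apply/matrixP => i k; rewrite !mxE ord1 eqxx andbT. Qed.

Lemma mx01_col (R : realType) (n m : nat) (A : 'M[bool]_(n, m)) (i : 'I_m) :
  mx01 R (col i A) = mx01 R A *m mx01 R (\col_k (k == i)).
Proof. by rewrite mx01_delta -colE; apply/matrixP => j k; rewrite !mxE. Qed.

Lemma feasible01_col (R : realType) (n m : nat) (A : 'M[bool]_(n, m)) (i : 'I_m) :
  feasible01 A (mx01 R (col i A)) (\col_k (k == i)).
Proof. by apply/forallP => j; rewrite mx01_col. Qed.

Lemma ratio_single (R : realType) (m : nat) (c d : 'cV[R]_m) (d0 : R) (i : 'I_m) :
  ratio c d d0 (\col_k (k == i)) = c i 0 / (d0 + d i 0).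
Proof. by rewrite /ratio /dotcv mx01_delta -!colE !mxE. Qed.

Section Ratio.
Variables (R : realType) (m : nat) (c d : 'cV[R]_m) (d0 : R).
Hypotheses (hc : forall i : 'I_m, 0 < c i 0) (hd : forall i : 'I_m, 0 <= d i 0).
Hypothesis hd0 : 0 < d0.
Implicit Type x : 'cV[bool]_m.

Let le_sum_d x i : x i 0 -> d i 0 <= \sum_(j | x j 0) d j 0.
Proof. by move=> xi; rewrite (bigD1 i) //= lerDl sumr_ge0. Qed.

Let le_price x i : x i 0 ->
  c i 0 / (d0 + \sum_(j | x j 0) d j 0) <= c i 0 / (d0 + d i 0).
Proof.
move=> xi; rewrite ler_pM2l // lef_pV2 ?posrE ?ltr_wpDr ?sumr_ge0 //.
by rewrite lerD2l le_sum_d.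
Qed.

Lemma ratio_le_lp x : ratio c d d0 x <= lp_objective c d d0 (mx01 R x).
Proof. by rewrite ratioE lp_objective01; apply: ler_sum => i; exact: le_price. Qed.

Lemma tight_sum_d x i : lp_objective c d d0 (mx01 R x) <= ratio c d d0 x ->
  x i 0 -> \sum_(j | x j 0) d j 0 = d i 0.
Proof.
move=> lp_le xi; apply/eqP; rewrite eq_le le_sum_d // andbT leNgt.
apply/negP => lt_d; move: lp_le; rewrite leNgt => /negP; apply.
rewrite ratioE lp_objective01 (bigD1 i) //= [ltRHS](bigD1 i) //=.
rewrite ltr_leD // ?ler_sum // => [|j /andP[xj _]]; last exact: le_price.
by rewrite ltr_pM2l // ltf_pV2 ?ltrD2l // posrE ltr_wpDr ?sumr_ge0.
Qed.

(** For a 0/1 vector x that vanishes outside K, sums over the support of x are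
    sums over the restriction of x to K. *)
Lemma sum_retain_cols (K : {set 'I_m}) (F : 'I_m -> R) x :
  (forall i, x i 0 -> i \in K) ->
  \sum_(i | x i 0) F i =
  \sum_(k < #|K|) F (enum_val k) * mx01 R (rowsub (fun k : 'I_#|K| => enum_val k) x) k 0.
Proof.
move=> xK; rewrite big_mkcond (bigID (mem K)) /= addrC big1 ?add0r => [|i /negP iK].
  rewrite [LHS]big_enum_val; apply: eq_bigr => k _; rewrite !mxE.
  by case: (x _ _); rewrite ?mulr1 ?mulr0.
by case: ifP => // /xK.
Qed.

Lemma feasible01_retain_cols (n : nat) (A : 'M[bool]_(n, m)) (w : 'cV[R]_n)
    (K : {set 'I_m}) x :
  (forall i, x i 0 -> i \in K) ->
  feasible01 (retain_cols K A) w (rowsub (fun k : 'I_#|K| => enum_val k) x) =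
  feasible01 A w x.
Proof.
move=> xK; apply: eq_forallb => j; congr (_ <= _).
transitivity (\sum_(i | x i 0) mx01 R A j i).
  rewrite (@sum_retain_cols _ _ _ xK) mxE; apply: eq_bigr => k _.
  by rewrite !mxE.
rewrite [RHS]mxE big_mkcond; apply: eq_bigr => i _; rewrite !mxE.
by case: (x i 0); rewrite ?mulr1 ?mulr0.
Qed.

Lemma ratio_packing x : (forall i, x i 0 -> i \in zero_idx d) ->
  ratio c d d0 x =
  packing_objective c d0 (rowsub (fun k : 'I_#|zero_idx d| => enum_val k) x).
Proof.
move=> xK; rewrite ratioE [X in d0 + X]big1 ?addr0; last first.
  by move=> i /xK; rewrite inE => /eqP.
by rewrite (@sum_retain_cols _ (fun i => c i 0 / d0) _ xK).
Qed.

(** The extremal case of [ratio_le_lp]: equality forces x to be 0, a single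
    column, or a packing of columns of K. *)
Lemma tight_ratio (n : nat) (A : 'M[bool]_(n, m)) x :
  feasible01 A (const_mx 1 : 'cV[R]_n) x ->
  lp_objective c d d0 (mx01 R x) <= ratio c d d0 x ->
  ratio c d d0 x <=
    Num.max (max_single c d d0) (max_packing (zero_idx d) A c d0).
Proof.
move=> xA lp_le; rewrite le_max.
have [/existsP[i /andP[xi di]]|] :=
    boolP [exists i, x i 0 && (0 < d i 0)].
  (* d^T x is both d_i and at least d_i + d_j, so no second column is chosen *)
  have x_i j : x j 0 -> j = i.
    move=> xj; apply/eqP/negPn/negP => ji.
    have dj : d j 0 = d i 0 by rewrite -!(tight_sum_d lp_le).
    have := tight_sum_d lp_le xi; rewrite (bigD1 i) //= (bigD1 j) ?xj //=.
    move/eqP; rewrite addrC -subr_eq0 addrK gt_eqF // dj ltr_wpDr //.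
    by rewrite sumr_ge0.
  have -> : x = \col_k (k == i).
    apply/matrixP => j k; rewrite ord1 mxE; apply/idP/eqP => [|->//].
    exact: x_i.
  by rewrite ratio_single /max_single le_bigmax_cond.
move=> /existsPn x0; apply/orP; right.
have xK i : x i 0 -> i \in zero_idx d.
  by move=> xi; have := x0 i; rewrite xi inE lt_neqAle hd andbT negbK eq_sym.
by rewrite ratio_packing // le_bigmax_cond // feasible01_retain_cols.
Qed.

Lemma single_or_packing_le_game (n : nat) (A : 'M[bool]_(n, m)) :
  Num.max (max_single c d d0) (max_packing (zero_idx d) A c d0) <=
  ratio_game A c d d0 (const_mx true).
Proof.
rewrite ge_max /ratio_game mx01_const1; apply/andP; split; apply/bigmax_leP.
  split=> [|i _]; first exact: bigmax_ge_id.
  rewrite -ratio_single; apply: le_bigmax_cond.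
  by apply/forallP => j; rewrite -mx01_col !mxE; case: (A j i).
split=> [|x xA]; first exact: bigmax_ge_id.
(* z is the extension by 0 of x to all columns *)
pose z : 'cV[bool]_m := \col_i [exists k, (enum_val k == i) && x k 0].
have zK i : z i 0 -> i \in zero_idx d.
  by rewrite mxE => /existsP[k /andP[/eqP <- _]]; exact: enum_valP.
have zx : rowsub (fun k : 'I_#|zero_idx d| => enum_val k) z = x.
  apply/matrixP => k l; rewrite ord1 !mxE; apply/existsP/idP => [[k']|xk].
    by case/andP=> /eqP/enum_val_inj ->.
  by exists k; rewrite eqxx.
rewrite -zx -ratio_packing //; apply: le_bigmax_cond.
by rewrite -(feasible01_retain_cols _ _ zK) zx.
Qed.

End Ratio.

(** * The core and the dual linear program *)

(** Stability on the unit vectors gives y >= 0, because nu is nonnegative;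
    stability on the columns of A gives A^T y >= p. *)
Lemma stable_dual (R : realType) (n m : nat) (A : 'M[bool]_(n, m))
    (c d : 'cV[R]_m) (d0 : R) (y : 'cV[R]_n) :
  (forall a, ratio_game A c d d0 a <= dotcv (mx01 R a) y) ->
  (forall j, 0 <= y j 0) /\
  (forall i, prices c d d0 i 0 <= ((mx01 R A)^T *m y) i 0).
Proof.
move=> y_stable; split=> [j|i].
  have := y_stable (\col_k (k == j)); rewrite mx01_delta.
  have -> : dotcv (delta_mx j 0) y = y j 0 by rewrite /dotcv trmx_delta -rowE mxE.
  by apply: le_trans; exact: bigmax_ge_id.
rewrite mxE -ratio_single.
have -> : ((mx01 R A)^T *m y) i 0 = dotcv (mx01 R (col i A)) y.
  by rewrite dotcvE mxE; apply: eq_bigr => j _; rewrite !mxE.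
by apply: le_trans (y_stable _); apply: le_bigmax_cond; exact: feasible01_col.
Qed.

Lemma dual_stable (R : realType) (n m : nat) (A : 'M[bool]_(n, m))
    (c d : 'cV[R]_m) (d0 : R) (y : 'cV[R]_n) :
  (forall i, 0 < c i 0) -> (forall i, 0 <= d i 0) -> 0 < d0 ->
  (forall j, 0 <= y j 0) ->
  (forall i, prices c d d0 i 0 <= ((mx01 R A)^T *m y) i 0) ->
  forall a, ratio_game A c d d0 a <= dotcv (mx01 R a) y.
Proof.
move=> hc hd hd0 y_ge0 y_dual a; apply/bigmax_leP; split=> [|x xA].
  by rewrite dotcvE sumr_ge0 // => j _; rewrite mulr_ge0 // mxE ler0n.
apply: le_trans (ratio_le_lp hc hd hd0 x) _; rewrite lp_objectiveE.
apply: (@lp_weak_duality _ _ _ (mx01 R A)) => //; last exact/forallP.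
by move=> i; rewrite mxE ler0n.
Qed.

Unset Implicit Arguments.

Theorem proposition5 (R : realType) (n m : nat) (hm : (2 <= m)%N)
    (A : 'M[bool]_(n, m)) (hA : forall j : 'I_m, col j A <> const_mx false)
    (c d : 'cV[R]_m) (d0 : R)
    (hc : forall i : 'I_m, 0 < c i 0) (hd : forall i : 'I_m, 0 <= d i 0) (hd0 : 0 < d0) :
  (core (ratio_game A c d d0) !=set0) <->
  is_max [set lp_objective c d d0 x | x in lp_feasible R A]
    (Num.max (max_single c d d0) (max_packing (zero_idx d) A c d0)).
Proof.
set V := Num.max _ _; split=> [[y [y_total y_stable]]|[[x0 [x0_ge0 Ax0] px0] pV]].
  have [y_ge0 y_dual] := stable_dual y_stable.
  have lp_le x : lp_feasible R A x ->
      lp_objective c d d0 x <= ratio_game A c d d0 (const_mx true).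
    move=> [/forallP x_ge0 /forallP Ax]; rewrite -y_total lp_objectiveE.
    apply: lp_weak_duality y_dual => // i.
    by have := x_ge0 i; rewrite mxE.
  have [[x xA ratio_x] _] := ratio_gameP A c d d0 (const_mx true).
  rewrite /= mx01_const1 in xA.
  have x_feas : lp_feasible R A (mx01 R x).
    by split=> //; apply/forallP => i; rewrite !mxE ler0n.
  have lp_x := lp_le _ x_feas; rewrite -ratio_x in lp_x.
  have defV : V = ratio_game A c d d0 (const_mx true).
    apply/eqP; rewrite eq_le single_or_packing_le_game // -ratio_x.
    exact: tight_ratio.
  rewrite defV; split; last by move=> _ [z /lp_le z_le <-].
  exists (mx01 R x) => //; apply/eqP; rewrite eq_le lp_le // -ratio_x.
  exact: ratio_le_lp.
have [|||y [y_ge0 y_dual y_le]] :=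
    @lp_strong_duality R n m (mx01 R A) (prices c d d0) x0 (const_mx 1) V.
- by move=> i; have /forallP/(_ i) := x0_ge0; rewrite mxE.
- exact/forallP.
- move=> x x_ge0 /forallP Ax; rewrite -/(dotcv _ x) -lp_objectiveE; apply: pV.
  by exists x => //; split=> //; apply/forallP => i; rewrite mxE.
have y_stable := dual_stable hc hd hd0 y_ge0 y_dual.
have := y_stable (const_mx true); rewrite mx01_const1 => game_le.
exists y; split=> //; apply/eqP; rewrite eq_le game_le andbT.
by rewrite (le_trans y_le) // single_or_packing_le_game.
Qed.
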